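(* Let $\Bbbk$ be a field of characteristic $0$ and $a_1,a_2,\ldots\in\Bbbk$. The multiplicative inverse of $$A(x)=1+a_1x+a_2\frac{x^2}{2!}+a_3\frac{x^3}{3!}+\cdots\quad\text{is}\quad \frac1{A(x)}=B(x)=1+b_1x+b_2\frac{x^2}{2!}+b_3\frac{x^3}{3!}+\cdots,$$ where for each $n\ge1$ $$b_n=\sum_{F\text{ face of }\pi_n}(-1)^{n-\dim F}a_F,$$ the sum being over the nonempty faces $F$ of the standard permutahedron $\pi_n$, and $a_F=a_{f_1}\cdots a_{f_k}$ for each face $F\cong\pi_{f_1}\times\cdots\times\pi_{f_k}$ of $\pi_n$.
   Context: The standard permutahedron $\pi_n\subset\mathbb R^n$ is the convex hull of the $n!$ permutations of $(1,\dots,n)$. Its nonempty faces are in bijection with the ordered sequences $(S_1,\dots,S_k)$ of nonempty pairwise disjoint sets with union $\{1,\dots,n\}$: the vertices of the face $\pi_{S_1,\dots,S_k}$ are the permutations $x$ for which $\{x_i:i\in S_1\}$ are the largest $|S_1|$ numbers in $\{1,\dots,n\}$, $\{x_i:i\in S_2\}$ the next largest $|S_2|$ numbers, and so on. This face has dimension $n-k$ and is a translate of $\pi_{S_1}\times\cdots\times\pi_{S_k}$, where $\pi_S$ is the standard permutahedron in $\mathbb R S$. The factorization $F\cong\pi_{f_1}\times\cdots\times\pi_{f_k}$ in the statement is this one, with $f_i=|S_i|$ (so $f_1+\cdots+f_k=n$, point factors $\pi_1$ being counted). *)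

(* Defs.v *)
From HB Require Import structures.
From mathcomp Require Import all_boot all_order all_algebra perm.
From mathcomp Require Import boolp classical_sets fsbigop reals convex.

Set Implicit Arguments.
Unset Strict Implicit.
Unset Printing Implicit Defensive.

Import Order.TTheory GRing.Theory Num.Theory.

Local Open Scope classical_set_scope.
Local Open Scope ring_scope.

Section FormalPowerSeries.
Variable K : fieldType.

(* A formal power series is its sequence of coefficients. *)
Definition fps : Type := nat -> K.

Definition fps_one : fps := fun n => (n == 0)%:R.

Definition fps_mul (f g : fps) : fps :=
  fun n => \sum_(i < n.+1) f i * g (n - i)%N.

Definition fps_inverse (f g : fps) : Prop :=
  fps_mul f g =1 fps_one /\ fps_mul g f =1 fps_one.

(* 1 + a_1 x + a_2 x^2/2! + ...; the entry [a 0] is not used. *)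
Definition egf1 (a : nat -> K) : fps :=
  fun n => if n is 0 then 1 else a n / n`!%:R.

End FormalPowerSeries.

Section Polytopes.
Variables (R : realType) (n : nat).

Definition conv_hull (A : set 'rV[R]_n) : set 'rV[R]_n :=
  smallest (fun B : set (convex_lmodType 'rV[R]_n) => convex_set B) A.

(* The points of P at which the linear functional y is maximal. *)
Definition face_in_direction (P : set 'rV[R]_n) (y : 'rV[R]_n) :
    set 'rV[R]_n :=
  [set p | P p /\
     forall q, P q -> \sum_(i < n) y 0 i * q 0 i <= \sum_(i < n) y 0 i * p 0 i].

(* P itself is the face in direction 0. *)
Definition faces (P : set 'rV[R]_n) : set (set 'rV[R]_n) :=
  [set F | F !=set0 /\ exists y, F = face_in_direction P y].

(* F contains d + 1 affinely independent points. *)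
Definition has_affine_rank (F : set 'rV[R]_n) (d : nat) : Prop :=
  exists (p : 'rV[R]_n) (V : 'M[R]_(d, n)),
    [/\ F p, forall i, F (p + row i V) & row_free V].

Definition poly_dim (F : set 'rV[R]_n) : nat :=
  \max_(d < n.+1 | `[< has_affine_rank F d >]) d.

End Polytopes.

Section Permutahedron.
Variables (R : realType) (n : nat).

(* 'I_n stands for {1, ..., n} through i |-> i + 1. *)
Definition perm_point (s : 'S_n) : 'rV[R]_n := \row_i (s i).+1%:R.

Definition permutahedron : set 'rV[R]_n := conv_hull (range perm_point).

Definition ordered_set_partition (S : seq {set 'I_n}) : Prop :=
  [/\ finset.set0 \notin S, pairwise (fun A B => A :&: B == finset.set0)%SET S
    & (\bigcup_(A <- S) A)%SET = finset.setT].

(* s sends S_1 onto the #|S_1| largest values, S_2 onto the #|S_2| next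
   largest ones, and so on; values are shifted down by 1 as above. *)
Definition compatible (S : seq {set 'I_n}) (s : 'S_n) : Prop :=
  forall k, (k < size S)%N ->
    [set s i | i in nth finset.set0 S k]%SET =
    [set v : 'I_n | (n - \sum_(A <- take k.+1 S) #|A| <= v
                      < n - \sum_(A <- take k S) #|A|)%N]%SET.

(* The face pi_{S_1, ..., S_k}. *)
Definition partition_face (S : seq {set 'I_n}) : set 'rV[R]_n :=
  conv_hull [set perm_point s | s in compatible S].

(* The sequence (S_1, ..., S_k) with F = pi_{S_1, ..., S_k}; F is then a
   translate of pi_{S_1} x ... x pi_{S_k}. *)
Definition face_partition (F : set 'rV[R]_n) : seq {set 'I_n} :=
  xget [::] [set S | ordered_set_partition S /\ F = partition_face S].

(* a_F = a_{f_1} ... a_{f_k} with f_i = #|S_i|. *)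
Definition face_coef (K : fieldType) (a : nat -> K) (F : set 'rV[R]_n) : K :=
  \prod_(A <- face_partition F) a #|A|.

End Permutahedron.

Arguments permutahedron R n : clear implicits.

(* Main.v *)
Require Import Defs.
From mathcomp Require Import all_boot all_order all_algebra perm.
From mathcomp Require Import boolp classical_sets fsbigop reals convex.
From mathcomp Require Import interval_inference ring lra zify.

(** Two independent facts combine.

    Combinatorics. Let W_n be the sum, over all ordered set partitions
    (S_1, ..., S_k) of an n-element set, of the products of the weights
    w_#|S_1| ... w_#|S_k|, with w_j = - a_j. Removing the first block S_1, which
    is an arbitrary nonempty subset, gives
      W_n = \sum_(1 <= j <= n) 'C(n, j) w_j W_(n - j)   for n > 0,
    that is, the n-th coefficient of A(x) W(x) vanishes for exponential
    generating functions ([osp_weightS], [egf1_inverse]). So it is enough to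
    show b_n = W_n.

    Geometry. A face of a convex hull in direction y is the hull of the
    generators at which y is maximal ([face_conv_hull]). For the permutahedron,
    an exchange argument shows that a maximizing permutation s is increasing
    along y: y_i < y_j implies s_i < s_j. If S lists the level sets of y by
    decreasing value, this says exactly that s is compatible with S
    ([compatibleP]), and y takes the same value at all compatible permutations,
    since two of them differ by a rearrangement inside the blocks. Hence the
    face is pi_S. Conversely S can be read off from its compatible permutations:
    i lies in an earlier block than j if and only if s_j < s_i for all of them.
    So S |-> pi_S is a bijection from ordered set partitions to faces ([facesE],
    [partition_face_inj]).

    Finally dim pi_S = n - k ([poly_dim_partition_face]): the k block sums are
    constant on pi_S, and the transpositions inside the blocks supply n - k
    independent directions. Therefore the sign (-1)^(n - dim F) is (-1)^k, and it
    is absorbed in the weights w_j = - a_j. *)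

Set Implicit Arguments.
Unset Strict Implicit.
Unset Printing Implicit Defensive.

Import Order.TTheory GRing.Theory Num.Theory.
Local Open Scope classical_set_scope.
Local Open Scope ring_scope.

(** * Enumeration of the ordered set partitions of a finite set *)

Section OrderedPartitions.
Variable I : finType.
Implicit Types (T A : {set I}) (S : seq {set I}).

(** Peeling off the first block, relative to an arbitrary ground set [T], is the
    form in which both the enumeration and the recurrence proceed. *)
Fixpoint is_osp T S : bool :=
  if S is A :: S' then
    [&& A != finset.set0, A \subset T & is_osp (T :\: A)%SET S']
  else T == finset.set0.

Lemma is_ospE T S :
  is_osp T S = [&& finset.set0 \notin S,
    pairwise (fun A B => A :&: B == finset.set0)%SET S
    & (\bigcup_(A <- S) A)%SET == T].
Proof.
elim: S T => [|A S IH] T /=; first by rewrite big_nil eq_sym.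
rewrite IH big_cons in_cons negb_or [finset.set0 == A]eq_sym.
case: (A != _) => //=; case: (finset.set0 \notin S) => //=; last by rewrite andbF.
case: (pairwise _ S); rewrite /= ?andbF ?andbT //.
set U := (\bigcup_(B <- S) B)%SET.
have -> : all (fun B => A :&: B == finset.set0)%SET S = (A :&: U == finset.set0)%SET.
  rewrite /U; elim: {IH U} S => [|B S IH] /=; first by rewrite big_nil finset.setI0 eqxx.
  by rewrite big_cons finset.setIUr finset.setU_eq0 IH.
apply/andP/andP => [[AT /eqP UE]|[/eqP AU0 /eqP <-]].
  rewrite UE finset.setIDA finset.setIC -finset.setIDA finset.setDv finset.setI0.
  by split=> //; rewrite -{1}(finset.setIidPr AT) finset.setID.
rewrite finset.subsetUl finset.setDUl finset.setDv finset.set0U; split=> //.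
by rewrite eq_sym; apply/eqP/finset.setDidPl; rewrite -finset.setI_eq0 finset.setIC AU0.
Qed.

(** [m] is a recursion bound; the value is meaningful as soon as [#|T| <= m]. *)
Fixpoint osps (m : nat) T : seq (seq {set I}) :=
  if T == finset.set0 then [:: [::]] else
  if m is m'.+1 then
    [seq A :: P | A <- enum [set A : {set I} | (A \subset T) && (A != finset.set0)]%SET,
                  P <- osps m' (T :\: A)%SET]
  else [::].

Lemma card_setD_lt T A : A != finset.set0 -> A \subset T -> (#|T :\: A| < #|T|)%N.
Proof.
move=> A0 AT; rewrite cardsD (finset.setIidPr AT).
have A1 : (0 < #|A|)%N by rewrite card_gt0.
by rewrite ltn_subrL A1 (leq_trans A1) // subset_leq_card.
Qed.

Lemma mem_osps m T S : (#|T| <= m)%N -> (S \in osps m T) = is_osp T S.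
Proof.
elim: m T S => [|m IH] T S Tm /=.
  have T0 : T = finset.set0 by apply/eqP; rewrite -cards_eq0 -leqn0.
  rewrite T0 eqxx; case: S => [|A S] /=; first by rewrite eqxx mem_seq1.
  by rewrite mem_seq1 finset.subset0; case: (A == _).
case: (altP (T =P finset.set0)) => [->|T0].
  by case: S => [|A S] /=; rewrite ?eqxx mem_seq1 // finset.subset0; case: (A == _).
apply/allpairsPdep/idP => [[A [S' [+ + ->]]]|].
  rewrite mem_enum inE => /andP[AT A0] /=; rewrite A0 AT /= IH //.
  by rewrite -ltnS (leq_trans (card_setD_lt A0 AT)).
case: S => [|A S] /=; first by rewrite (negPf T0).
move=> /and3P[A0 AT SP]; exists A, S; split=> //; first by rewrite mem_enum inE AT.
by rewrite IH // -ltnS (leq_trans (card_setD_lt A0 AT)).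
Qed.

Lemma osps_uniq m T : uniq (osps m T).
Proof.
elim: m T => [|m IH] T /=; case: (T == _) => //.
apply: allpairs_uniq_dep => //; first exact: enum_uniq.
by move=> /= [A S] [A' S'] _ _ /= [-> ->].
Qed.

Lemma sum_subset_card (K : pzRingType) T (g : nat -> K) :
  \sum_(A : {set I} | A \subset T) g #|A| =
  \sum_(k < #|T|.+1) g k *+ 'C(#|T|, k).
Proof.
rewrite (partition_big (fun A : {set I} => inord #|A| : 'I_#|T|.+1) predT) //=.
apply: eq_bigr => k _; rewrite -cards_draws -sum1dep_card -sumrMnr.
rewrite [RHS](eq_bigl _ _ (fun A => _ : _ = ((A \subset T) && (inord #|A| == k)))).
  by apply: eq_bigr => A /andP[AT /eqP <-]; rewrite mulr1n inordK // ltnS subset_leq_card.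
move=> A; case AT: (A \subset T) => //=.
by rewrite -val_eqE /= inordK // ltnS subset_leq_card.
Qed.

End OrderedPartitions.

(** * The recurrence for weighted sums over ordered set partitions *)

Section OspSum.
Variables (K : comPzRingType) (w : nat -> K).

Definition osp_sum (I : finType) m (T : {set I}) : K :=
  \sum_(S <- osps m T) \prod_(A <- S) w #|A|.

Definition osp_weight (n : nat) : K := osp_sum n [set: 'I_n]%SET.

Lemma osp_sum0 (I : finType) m (T : {set I}) : #|T| = 0%N -> osp_sum m T = 1.
Proof.
move=> /eqP; rewrite cards_eq0 => /eqP ->.
by rewrite /osp_sum; case: m => [|m] /=; rewrite eqxx big_seq1 big_nil.
Qed.

Lemma osp_sumS (I : finType) m (T : {set I}) : T != finset.set0 ->
  osp_sum m.+1 T =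
  \sum_(A : {set I} | (A \subset T) && (A != finset.set0))
     w #|A| * osp_sum m (T :\: A).
Proof.
move=> /negPf T0; rewrite /osp_sum /= T0 big_allpairs_dep big_enum /=.
apply: eq_big => [A|A _]; first by rewrite inE.
by rewrite big_distrr /=; apply: eq_bigr => S _; rewrite big_cons.
Qed.

(** The sum over the remaining blocks is assumed to depend only on the size of
    the remaining set, so that the choices of the first block can be grouped by
    cardinality. The function [h] stays arbitrary because this recurrence is
    what proves, by induction, that such an [h] exists. *)
Lemma osp_sum_rec (I : finType) m (T : {set I}) n (h : nat -> K) :
  #|T| = n.+1 ->
  (forall A : {set I}, (#|A| <= n)%N -> (#|A| <= m)%N -> osp_sum m A = h #|A|) ->
  (n <= m)%N ->
  osp_sum m.+1 T = \sum_(k < n.+1) w k.+1 * h (n - k)%N *+ 'C(n.+1, k.+1).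
Proof.
move=> ET hE nm; rewrite osp_sumS; last by rewrite -card_gt0 ET.
(* The empty subset is not a possible first block: give it weight 0. *)
pose g k := if k is 0 then 0 else w k * h (n.+1 - k)%N.
transitivity (\sum_(k < n.+2) g k *+ 'C(n.+1, k)); last first.
  by rewrite big_ord_recl /= mul0rn add0r.
rewrite -ET -sum_subset_card big_mkcondr /=; apply: eq_bigr => A AT.
rewrite -cards_eq0 /g; case EA : #|A| => [|k] //=; rewrite -EA.
have A0 : A != finset.set0 by rewrite -card_gt0 EA.
have TA := card_setD_lt A0 AT; rewrite ET ltnS in TA.
by rewrite hE ?(leq_trans TA nm) // cardsD (finset.setIidPr AT) ET.
Qed.

(** Transport of structure without bijections: on both sides the recurrence
    [osp_sum_rec] expresses the sum through smaller sets. *)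
Lemma osp_sum_card (I : finType) m (T : {set I}) :
  (#|T| <= m)%N -> osp_sum m T = osp_weight #|T|.
Proof.
move En : #|T| => n; elim/ltn_ind: n I m T En => n IH I m T En Tm.
case: n => [|n] in IH En Tm *; first by rewrite /osp_weight !osp_sum0 ?cardsT ?card_ord.
have IHn J p (A : {set J}) : (#|A| <= n)%N -> (#|A| <= p)%N ->
    osp_sum p A = osp_weight #|A| by move=> An Ap; apply: IH.
case: m => // m in Tm *; rewrite (osp_sum_rec En (IHn _ _) Tm).
have cT : #|[set: 'I_n.+1]%SET| = n.+1 by rewrite cardsT card_ord.
by rewrite /osp_weight (osp_sum_rec cT (IHn _ _) (leqnn n)).
Qed.

Lemma osp_weight0 : osp_weight 0 = 1.
Proof. by rewrite /osp_weight osp_sum0 // cardsT card_ord. Qed.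

Lemma osp_weightS n :
  osp_weight n.+1 =
  \sum_(k < n.+1) w k.+1 * osp_weight (n - k) *+ 'C(n.+1, k.+1).
Proof.
have cT : #|[set: 'I_n.+1]%SET| = n.+1 by rewrite cardsT card_ord.
apply: (osp_sum_rec cT) => // A _; exact: osp_sum_card.
Qed.

End OspSum.

Section Egf.
Variable K : fieldType.
Hypothesis charK0 : [pchar K] =i pred0.

Lemma fact_neq0 n : n`!%:R != 0 :> K.
Proof. by rewrite ((pcharf0P K).1 charK0) -lt0n fact_gt0. Qed.

(** Dividing the recurrence by n! turns its binomial coefficients into the
    Cauchy product; the term of index 0 of that product is the left-hand side of
    the recurrence. This is where characteristic 0 enters. *)
Lemma egf1_inverse (a b : nat -> K) :
  (forall n, (0 < n)%N -> b n = osp_weight (fun k => - a k) n) ->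
  fps_inverse (egf1 a) (egf1 b).
Proof.
move=> bE; set w := fun k => - a k.
have mulab : fps_mul (egf1 a) (egf1 b) =1 fps_one K.
  case=> [|n]; rewrite /fps_mul /fps_one.
    by rewrite big_ord_recl big_ord0 /= mulr1 addr0.
  have egf1b k : egf1 b k = osp_weight w k / k`!%:R.
    by case: k => [|k] /=; rewrite ?osp_weight0 ?fact0 ?divr1 // bE.
  rewrite big_ord_recl subn0 egf1b osp_weightS -[egf1 a (@ord0 n.+1)]/1 mul1r.
  rewrite mulr_suml -big_split; apply: big1 => k _.
  rewrite -[LHS]/(_ + _) lift0 -[egf1 a k.+1]/(a k.+1 / k.+1`!%:R) subSS egf1b -[w k.+1]/(- a k.+1).
  have -> : n.+1`!%:R = 'C(n.+1, k.+1)%:R * (k.+1`!%:R * (n - k)`!%:R) :> K.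
    by rewrite -!natrM -(bin_fact (ltn_ord k)).
  rewrite -mulr_natr; have := fact_neq0 k.+1; have := fact_neq0 (n - k).
  have : 'C(n.+1, k.+1)%:R != 0 :> K.
    by rewrite ((pcharf0P K).1 charK0) -lt0n bin_gt0 ltnS -ltnS.
  move: ('C(n.+1, k.+1)%:R : K) ((n - k)`!%:R : K) (k.+1`!%:R : K).
  move: (osp_weight w (n - k)) => o c f g c0 f0 g0.
  by field; rewrite c0 f0 g0.
split=> // n; rewrite -mulab /fps_mul (reindex_inj rev_ord_inj) /=.
by apply: eq_bigr => i _; rewrite mulrC subSS subKn // -ltnS.
Qed.

End Egf.

(** * Ordered set partitions as rankings, and compatible permutations *)

Section Blocks.
Variable n : nat.
Implicit Types (S : seq {set 'I_n}) (s : 'S_n).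

(** The position of the block containing [i]. Everything below depends on an
    ordered set partition only through this ranking of ['I_n]. *)
Definition block S (i : 'I_n) : nat := find (fun A : {set 'I_n} => i \in A) S.

Section OrderedSetPartition.
Variable S : seq {set 'I_n}.
Hypothesis ospS : ordered_set_partition S.

Lemma block_lt i : (block S i < size S)%N.
Proof.
rewrite /block -has_find; case: ospS => _ _ U.
have : i \in (\bigcup_(A <- S) A)%SET by rewrite U inE.
elim: {U} S => [|A S' IH] /=; first by rewrite big_nil inE.
by rewrite big_cons inE => /orP[->//|/IH ->]; rewrite orbT.
Qed.

Lemma mem_nth_block k i : (k < size S)%N ->
  (i \in nth finset.set0 S k) = (block S i == k).
Proof.
move=> kS; apply/idP/eqP => [ik|<-]; last first.
  by apply: (@nth_find _ finset.set0 (fun A : {set 'I_n} => i \in A)); rewrite has_find block_lt.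
case: ospS => _ /(pairwiseP finset.set0) disjS _.
have ib : i \in nth finset.set0 S (block S i).
  by apply: (@nth_find _ finset.set0 (fun A : {set 'I_n} => i \in A)); rewrite has_find block_lt.
have [bk|kb|//] := ltngtP (block S i) k.
  have /eqP/setP/(_ i) := disjS _ _ (block_lt i) kS bk.
  by rewrite !inE ib ik.
have /eqP/setP/(_ i) := disjS _ _ kS (block_lt i) kb.
by rewrite !inE ib ik.
Qed.

Lemma block_surj k : (k < size S)%N -> exists i, block S i = k.
Proof.
move=> kS; case: ospS => S0 _ _.
have /set0Pn[i] : nth finset.set0 S k != finset.set0.
  by apply: contraNneq S0 => <-; exact: mem_nth.
by rewrite mem_nth_block // => /eqP <-; exists i.
Qed.

(** These sums bound the windows of values in the definition of [compatible]. *)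
Lemma sum_take k : (k <= size S)%N ->
  \sum_(A <- take k S) #|A| = #|[set i | (block S i < k)%N]%SET|.
Proof.
elim: k => [|k IH] kS.
  rewrite take0 big_nil; apply/esym/eqP; rewrite cards_eq0.
  by apply/eqP/setP => i; rewrite !inE.
rewrite (take_nth finset.set0) // -cats1 big_cat /= big_seq1 IH ?(ltnW kS) //.
have disj : ([set i | (block S i < k)%N] :&: nth finset.set0 S k = finset.set0)%SET.
  apply/setP => i; rewrite !inE mem_nth_block //.
  by apply/negP => /andP[+ /eqP bk]; rewrite bk ltnn.
rewrite -[LHS]/(_ + _)%N -cardsUI disj cards0 addn0; apply: eq_card => i.
by rewrite !inE mem_nth_block // [RHS]ltnS [RHS]leq_eqVlt orbC.
Qed.

End OrderedSetPartition.

Lemma card_geq_ord v : #|[set w : 'I_n | (v <= w)%N]%SET| = (n - v)%N.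
Proof.
rewrite cardsE -sum1_card big_mkcond /=.
rewrite -(big_mkord xpredT (fun w => if (v <= w)%N then 1%N else 0%N)).
have [vn|nv] := leqP v n.
  rewrite (big_cat_nat (leq0n v) vn) //= big_nat big1 ?add0n => [|i /andP[_ iv]]; last first.
    by rewrite leqNgt iv.
  rewrite big_nat (eq_bigr (fun=> 1%N)) => [|i /andP[->]//].
  by rewrite -big_nat sum_nat_const_nat muln1.
rewrite big_nat big1 => [|i /andP[_ iv]]; last by rewrite leqNgt (ltn_trans iv).
by apply/esym/eqP; rewrite subn_eq0 ltnW.
Qed.

(** Compatibility asks for images to be intervals at the top of ['I_n], whereas
    monotonicity only yields closure under larger values: by counting, the two
    agree. *)
Lemma up_closedE (U : {set 'I_n}) :
  (forall v w : 'I_n, v \in U -> (v < w)%N -> w \in U) ->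
  U = [set v : 'I_n | (n - #|U| <= v)%N]%SET.
Proof.
move=> up; apply/setP => v; rewrite inE; apply/idP/idP => [vU|].
  have : (n - v <= #|U|)%N.
    rewrite -card_geq_ord; apply: subset_leq_card; apply/fintype.subsetP => w.
    by rewrite inE leq_eqVlt => /orP[/eqP/val_inj <-//|]; exact: up vU.
  lia.
apply: contraLR => vU; rewrite -ltnNge.
have : (#|U| <= n - v.+1)%N.
  rewrite -card_geq_ord; apply: subset_leq_card; apply/fintype.subsetP => w wU.
  rewrite inE ltnNge leq_eqVlt negb_or; apply/andP; split.
    by apply: contra vU => /eqP/val_inj <-.
  by apply: contra vU => wv; exact: up wU wv.
by have := ltn_ord v; lia.
Qed.

(** The union of the first k blocks is sent onto an up-closed set if and only if
    no later element receives a larger value; the window of the block of index k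
    is a difference of two such up-closed sets. *)
Lemma compatibleP S s : ordered_set_partition S ->
  compatible S s <-> (forall i j, (block S i < block S j)%N -> (s j < s i)%N).
Proof.
move=> ospS; split=> [cSs i j bij|mono].
  have cblock k l : block S k = l ->
      (n - #|[set i | (block S i < l.+1)%N]%SET| <= s k
        < n - #|[set i | (block S i < l)%N]%SET|)%N.
    move=> kl; have lS : (l < size S)%N by rewrite -kl block_lt.
    have : s k \in [set s i | i in nth finset.set0 S l]%SET.
      by apply: imset_f; rewrite mem_nth_block // kl.
    by rewrite cSs // inE !sum_take // ltnW.
  have /andP[lei _] := cblock i _ erefl; have /andP[_ ltj] := cblock j _ erefl.
  apply: leq_trans ltj (leq_trans _ lei); apply: leq_sub2l.
  apply: subset_leq_card; apply/fintype.subsetP => k; rewrite !inE => ki.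
  exact: leq_trans ki bij.
(* The values given to the first k blocks are the largest ones. *)
have top k : (s @: [set i | (block S i < k)%N] =
    [set v : 'I_n | (n - #|[set i | (block S i < k)%N]%SET| <= v)%N])%SET.
  rewrite -[in RHS](card_imset _ (@perm_inj _ s)); apply: up_closedE.
  move=> v w /imsetP[i]; rewrite inE => ik -> lt_w.
  apply/imsetP; exists (s^-1%g w); rewrite ?permKV // inE ltnNge.
  apply/negP => kw; have := mono _ _ (leq_trans ik kw).
  by rewrite permKV => /(ltn_trans lt_w); rewrite ltnn.
move=> k kS; rewrite !sum_take // ?(ltnW kS) //; apply/setP => v.
have topv l : (n - #|[set i | (block S i < l)%N]%SET| <= v)%N =
    (block S (s^-1%g v) < l)%N.
  have /setP/(_ v) := top l; rewrite inE => <-.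
  rewrite -[v in LHS](permKV s) finset.mem_imset ?inE //; exact: perm_inj.
rewrite inE [(v < _)%N]ltnNge !topv -leqNgt ltnS -eqn_leq.
rewrite -[v in LHS](permKV s) finset.mem_imset ?mem_nth_block //; exact: perm_inj.
Qed.

(** The blocks before that of [i] are nonempty, so [i] sits above a chain
    i_0, i_1, ... with one element in each of them, and [S'] must respect that
    chain. Applied in both directions, the order between blocks determines
    [block]. *)
Lemma leq_block S S' : ordered_set_partition S ->
  (forall i j, (block S i < block S j)%N -> (block S' i < block S' j)%N) ->
  forall i, (block S i <= block S' i)%N.
Proof.
move=> ospS SS' i; move Em : (block S i) => m.
elim: m i Em => // m IH i Em.
have [j Ej] : exists j, block S j = m.
  by apply: block_surj => //; rewrite ltnW // -Em block_lt.
by apply: leq_ltn_trans (IH _ Ej) _; apply: SS'; rewrite Ej Em.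
Qed.

Lemma block_inj S S' : ordered_set_partition S -> ordered_set_partition S' ->
  block S =1 block S' -> S = S'.
Proof.
move=> ospS ospS' SS'.
have leS P P' : ordered_set_partition P -> ordered_set_partition P' ->
    block P =1 block P' -> (size P <= size P')%N.
  move=> ospP ospP' PP'; rewrite leqNgt; apply/negP => lt.
  by have [i Ei] := block_surj ospP lt; have := block_lt ospP' i; rewrite -PP' Ei ltnn.
have eqS : size S = size S'.
  by apply/eqP; rewrite eqn_leq !leS // => i; rewrite SS'.
apply: (@eq_from_nth _ finset.set0) => // k kS; apply/setP => i.
by rewrite !mem_nth_block // -?eqS // SS'.
Qed.

(** Applied to [- y], this gives the partition attached to a direction [y]: the
    first block consists of the coordinates where [y] is largest. *)
Lemma exists_osp (d : Order.disp_t) (T : orderType d) (y : 'I_n -> T) :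
  exists S, ordered_set_partition S /\
    forall i j, (block S i < block S j)%N = (y i < y j)%O.
Proof.
pose vs := sort <=%O (undup (codom y)).
pose level v := [set i | y i == v]%SET.
have yvs i : y i \in vs by rewrite mem_sort mem_undup codom_f.
have svs : sorted <%O vs.
  by rewrite sort_lt_sorted undup_uniq.
have blockE i : block (map level vs) i = index (y i) vs.
  rewrite /block find_map; apply: eq_find => v /=.
  by rewrite inE eq_sym.
exists (map level vs); split; last first.
  move=> i j; rewrite !blockE; apply/idP/idP => [lt|].
    apply: (sorted_ltn_index _ svs) lt => //; exact: lt_trans.
  apply: contraLR; rewrite -leqNgt leq_eqVlt -leNgt => /orP[/eqP ji|lt].
    by rewrite -[y i](nth_index (y i) (yvs i)) -ji nth_index.
  apply: ltW; apply: (sorted_ltn_index _ svs) lt => //; exact: lt_trans.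
split.
- apply/mapP => -[v]; rewrite mem_sort mem_undup => /codomP[i ->].
  by move/setP/(_ i); rewrite !inE eqxx.
- rewrite pairwise_map; apply: sub_pairwise (_ : pairwise (fun u v => u != v) vs).
    move=> u v /= uv; apply/eqP/setP => i; rewrite !inE.
    by apply: contra_neqF uv => /andP[/eqP <- /eqP].
  by rewrite -uniq_pairwise sort_uniq undup_uniq.
- apply/setP => i; rewrite inE big_map.
  have := yvs i; elim: (vs) => // v r IH; rewrite inE big_cons finset.in_setU.
  by case/orP => [yv|/IH ->]; rewrite ?orbT // inE yv.
Qed.

End Blocks.

(** * Faces of a convex hull *)

Section ConvexHull.
Variables (R : realType) (n : nat).
Implicit Types (A B : set 'rV[R]_n) (y p q : 'rV[R]_n).

Definition dot y p : R := \sum_(i < n) y 0 i * p 0 i.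

Lemma dot_comb y p q (u v : R) : dot y (u *: p + v *: q) = u * dot y p + v * dot y q.
Proof.
rewrite /dot !mulr_sumr -big_split /=; apply: eq_bigr => i _.
by rewrite !mxE; ring.
Qed.

Lemma convex_set_comb A :
  (forall x z (t : R), 0 < t -> t < 1 -> A x -> A z -> A (t *: x + (1 - t) *: z)) ->
  convex_set (A : set (convex_lmodType 'rV[R]_n)).
Proof.
move=> cA; apply/convex_setW => x z; rewrite !inE => Ax Az k k0 k1.
by rewrite inE; exact: cA.
Qed.

Lemma convex_conv_hull A :
  convex_set (conv_hull A : set (convex_lmodType 'rV[R]_n)).
Proof.
move=> x z k; rewrite !inE => Ax Az B [cB AB].
by have := cB x z k; rewrite !inE; apply; [apply: Ax|apply: Az].
Qed.

Lemma sub_conv_hull A : A `<=` conv_hull A.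
Proof. exact: sub_gen_smallest. Qed.

Lemma conv_hull_sub A B :
  (forall x z (t : R), 0 < t -> t < 1 -> B x -> B z -> B (t *: x + (1 - t) *: z)) ->
  A `<=` B -> conv_hull A `<=` B.
Proof. by move=> /convex_set_comb cB AB; apply: smallest_sub. Qed.

Lemma dot_conv_hull_le A y (c : R) :
  (forall p, A p -> dot y p <= c) -> forall p, conv_hull A p -> dot y p <= c.
Proof.
move=> Ac; apply: conv_hull_sub => // x z t t0 t1 xc zc.
by rewrite dot_comb; nra.
Qed.

Definition vertex_max A y : set 'rV[R]_n :=
  [set p | A p /\ forall q, A q -> dot y q <= dot y p].

(** No explicit convex combinations are needed: the points that satisfy
    [dot y q <= max], and that lie in the hull of the maximizing generators
    whenever equality holds, form a convex set containing [A]. *)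
Lemma face_conv_hull A y : vertex_max A y !=set0 ->
  face_in_direction (conv_hull A) y = conv_hull (vertex_max A y).
Proof.
case=> p0 [Ap0 maxp0].
have hull_le := dot_conv_hull_le maxp0.
apply/seteqP; split=> [p [Ap maxp]|].
  have /(_ p Ap) [_] : conv_hull A `<=`
      [set q | dot y q <= dot y p0 /\
               (dot y q = dot y p0 -> conv_hull (vertex_max A y) q)].
    apply: conv_hull_sub => [x z t t0 t1 [xle xE] [zle zE]|q Aq].
      rewrite /= dot_comb; split; first by nra.
      (* As 0 < t < 1, the combination is maximal only if both ends are. *)
      move=> E.
      have xm : dot y x = dot y p0 by nra.
      have zm : dot y z = dot y p0 by nra.
      pose k : {i01 R} := Itv01 (ltW t0) (ltW t1).
      by have := @convex_conv_hull (vertex_max A y) x z k; rewrite !inE; apply; auto.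
    split=> [|Eq]; first exact: maxp0.
    by apply: sub_conv_hull; split=> // r /maxp0; rewrite Eq.
  apply; apply/eqP; rewrite eq_le hull_le //.
  exact: maxp (sub_conv_hull Ap0).
have Max_eq q : vertex_max A y q -> dot y q = dot y p0.
  by move=> [Aq maxq]; apply/eqP; rewrite eq_le maxp0 // maxq.
suff : conv_hull (vertex_max A y) `<=` [set q | conv_hull A q /\ dot y q = dot y p0].
  by move=> H p /H [Ap E]; split=> // q /hull_le; rewrite -/(dot y p) E.
apply: conv_hull_sub => [x z t t0 t1 [Ax Ex] [Az Ez]|q Vq].
  split; last by rewrite dot_comb Ex Ez; ring.
  pose k : {i01 R} := Itv01 (ltW t0) (ltW t1).
  by have := @convex_conv_hull A x z k; rewrite !inE; apply.
by split; [apply: sub_conv_hull; case: Vq|exact: Max_eq].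
Qed.

Lemma face_conv_hull_vertex A y p : A p ->
  face_in_direction (conv_hull A) y p -> vertex_max A y p.
Proof. by move=> Ap [_ maxp]; split=> // q Aq; apply: maxp; exact: sub_conv_hull. Qed.

End ConvexHull.

(** * Faces of the permutahedron *)

Section Faces.
Variables (R : realType) (n : nat).
Implicit Types (S : seq {set 'I_n}) (s t : 'S_n) (y : 'rV[R]_n).

Local Notation point := (@perm_point R n).

Lemma perm_point_inj : injective point.
Proof.
move=> s t /rowP st; apply/permP => i; have := st i; rewrite !mxE.
by move/eqP; rewrite eqr_nat eqSS => /eqP/val_inj.
Qed.

(** Exchanging two values moves a vertex along the edge direction e_i - e_j. This
    serves both for the exchange argument and for the dimension count. *)
Lemma perm_point_tperm s i j : point (tperm i j * s)%g =
  point s + (point s 0 j - point s 0 i) *: (delta_mx 0 i - delta_mx 0 j).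
Proof.
apply/rowP => k; rewrite !mxE permM eqxx /= ![k == _]eq_sym.
case: tpermP => [->|->|/eqP ki /eqP kj]; rewrite ?eqxx.
- by case: (altP (j =P i)) => [->|_]; rewrite /=; ring.
- by case: (altP (i =P j)) => [->|_]; rewrite /=; ring.
- by rewrite ![_ == k]eq_sym (negPf ki) (negPf kj) /=; ring.
Qed.

Lemma dot_delta y i : dot y (delta_mx 0 i) = y 0 i.
Proof.
rewrite /dot (bigD1 i) //= mxE !eqxx mulr1 big1 ?addr0 // => j ji.
by rewrite mxE (negPf ji) andbF mulr0.
Qed.

(** The exchange argument: if y_i < y_j and s_j < s_i, exchanging these two
    values changes the objective by (y_j - y_i) (s_i - s_j) > 0. *)
Lemma vertex_max_monotone y s : vertex_max (range point) y (point s) ->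
  forall i j, y 0 i < y 0 j -> (s i < s j)%N.
Proof.
move=> [_ maxs] i j yij; rewrite ltnNge; apply/negP => sji.
have nij : i != j by apply: contraTneq yij => ->; rewrite ltxx.
have lt_s : (s j < s i)%N.
  rewrite ltn_neqAle sji andbT; apply: contra nij => /eqP/val_inj/perm_inj ->.
  exact: eqxx.
have := maxs (point (tperm i j * s)%g) (imageT _ _).
rewrite perm_point_tperm -[X in dot y (X + _)]scale1r dot_comb mul1r.
rewrite -[delta_mx 0 i]scale1r -scaleN1r dot_comb !dot_delta !mxE.
have : (s j).+1%:R < (s i).+1%:R :> R by rewrite ltr_nat ltnS.
by nra.
Qed.

(** Two compatible permutations assign the same window of values to each block,
    so t^-1 o s permutes every block. *)
Lemma compatible_block S s t i : ordered_set_partition S ->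
  compatible S s -> compatible S t -> block S (t^-1%g (s i)) = block S i.
Proof.
move=> ospS cs ct; set k := block S i.
have kS : (k < size S)%N by exact: block_lt.
have : s i \in [set s i | i in nth finset.set0 S k]%SET.
  by apply: imset_f; rewrite mem_nth_block.
rewrite cs // -ct // => /imsetP[j + ->].
by rewrite permK mem_nth_block // => /eqP.
Qed.

Lemma compatible_tperm S s i j : ordered_set_partition S ->
  block S i = block S j -> compatible S s -> compatible S (tperm i j * s)%g.
Proof.
move=> ospS bij /(compatibleP s ospS) cs; apply/(compatibleP _ ospS) => k l kl.
have bt m : block S (tperm i j m) = block S m by case: tpermP => // ->.
by rewrite !permM; apply: cs; rewrite !bt.
Qed.

(** Reindex by t^-1 o s, which preserves the blocks and hence [y]. *)
Lemma dot_compatible y S s t : ordered_set_partition S ->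
  (forall i j, block S i = block S j -> y 0 i = y 0 j) ->
  compatible S s -> compatible S t -> dot y (point s) = dot y (point t).
Proof.
move=> ospS yS cs ct; rewrite /dot [RHS](reindex_inj (@perm_inj _ (s * t^-1)%g)) /=.
apply: eq_bigr => i _; rewrite !mxE permM permKV; congr (_ * _).
by apply: yS; rewrite compatible_block.
Qed.

Section Direction.
Variables (y : 'rV[R]_n) (S : seq {set 'I_n}).
Hypothesis ospS : ordered_set_partition S.
Hypothesis yS : forall i j, (block S i < block S j)%N = (y 0 j < y 0 i).

Lemma vertex_max_compatible s :
  vertex_max (range point) y (point s) -> compatible S s.
Proof.
move=> /vertex_max_monotone mono; apply/compatibleP => // i j.
by rewrite yS; exact: mono.
Qed.

Lemma exists_vertex_max : exists s, vertex_max (range point) y (point s).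
Proof.
pose s := [arg max_(s > (1%g : 'S_n)) dot y (point s)]%O.
exists s; split=> [|_ [t _ <-]]; first exact: imageT.
by rewrite /s; case: arg_maxP => // s' _; apply.
Qed.

(** A maximizer exists and is compatible, and all compatible permutations give
    the same value as it does. *)
Lemma vertex_maxE :
  vertex_max (range point) y = [set point s | s in compatible S].
Proof.
have [t maxt] := exists_vertex_max.
apply/seteqP; split=> [_ [[s _ <-] maxs]|_ [s cs <-]].
  by exists s => //; apply: vertex_max_compatible; split.
split=> [|q /maxt.2]; first exact: imageT.
rewrite (dot_compatible ospS _ cs (vertex_max_compatible maxt)) // => i j bij.
by apply/eqP; rewrite eq_le !leNgt -!yS bij ltnn.
Qed.

Lemma face_in_directionE :
  face_in_direction (permutahedron R n) y = partition_face S.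
Proof.
rewrite /permutahedron face_conv_hull /partition_face -?vertex_maxE //.
by have [s ?] := exists_vertex_max; exists (point s).
Qed.

End Direction.

(** A functional whose level sets are the blocks of [S], the first one being the
    highest. *)
Definition block_direction S : 'rV[R]_n := \row_i - (block S i)%:R.

Lemma block_directionP S i j :
  (block S i < block S j)%N = (block_direction S 0 j < block_direction S 0 i).
Proof. by rewrite !mxE ltrN2 ltr_nat. Qed.

Lemma exists_compatible S : ordered_set_partition S -> exists s, compatible S s.
Proof.
move=> ospS; have [s maxs] := exists_vertex_max (block_direction S).
by exists s; apply: vertex_max_compatible (block_directionP S) _ maxs.
Qed.

Lemma partition_face_vertex S s : ordered_set_partition S ->
  partition_face S (point s) -> compatible S s.
Proof.
move=> ospS; rewrite -(face_in_directionE ospS (block_directionP S)).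
move=> /(face_conv_hull_vertex (imageT _ s)).
by rewrite (vertex_maxE ospS (block_directionP S)) => -[t ct /perm_point_inj <-].
Qed.

(** The face determines its vertices, hence the compatible permutations, and
    these determine the order between blocks. Indeed let [i] come before [j] for
    one partition, so that s_j < s_i for every compatible s. If [j] came before
    [i] for the other one, s_i < s_j would follow; if they shared a block there,
    exchanging s_i and s_j would give another compatible permutation, with the
    two values in the wrong order. *)
Lemma partition_face_inj S S' :
  ordered_set_partition S -> ordered_set_partition S' ->
  partition_face S = partition_face S' :> set 'rV[R]_n -> S = S'.
Proof.
have block_ltP P P' i j : ordered_set_partition P -> ordered_set_partition P' ->
    partition_face P = partition_face P' :> set 'rV[R]_n ->
    (block P i < block P j)%N -> (block P' i < block P' j)%N.
  move=> ospP ospP' PP' bij; rewrite ltnNge; apply/negP.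
  have [s cs] := exists_compatible ospP.
  (* Compatible permutations are the vertices lying on the common face. *)
  have cP t : compatible P t <-> compatible P' t.
    split=> ct; apply: partition_face_vertex => //.
      by rewrite -PP'; apply: sub_conv_hull; exists t.
    by rewrite PP'; apply: sub_conv_hull; exists t.
  have lt_s := (compatibleP s ospP).1 cs i j bij.
  rewrite leq_eqVlt => /orP[/eqP bji|bji].
    have /cP/(compatibleP _ ospP)/(_ i j bij) :=
      compatible_tperm ospP' bji ((cP s).1 cs).
    by rewrite !permM tpermL tpermR => /(ltn_trans lt_s); rewrite ltnn.
  have := (compatibleP s ospP').1 ((cP s).1 cs) j i bji.
  by move/(ltn_trans lt_s); rewrite ltnn.
move=> ospS ospS' SS'; apply: block_inj => // i.
by apply/eqP; rewrite eqn_leq !leq_block // => k l; exact: block_ltP.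
Qed.

Lemma facesE :
  faces (permutahedron R n) = @partition_face R n @` @ordered_set_partition n.
Proof.
apply/seteqP; split=> [_ [_ [y ->]]|_ [S ospS <-]].
  have [S [ospS yS]] := exists_osp (fun i => - y 0 i).
  exists S => //; rewrite (@face_in_directionE y S) // => i j.
  by rewrite yS ltrN2.
split; last by exists (block_direction S); rewrite (face_in_directionE ospS (block_directionP S)).
have [s cs] := exists_compatible ospS.
by exists (point s); apply: sub_conv_hull; exists s.
Qed.

Lemma face_partitionK S : ordered_set_partition S ->
  face_partition (partition_face S : set 'rV[R]_n) = S.
Proof.
move=> ospS; apply: xget_unique => [|S' [ospS' SS']]; first by [].
by apply: partition_face_inj.
Qed.

End Faces.

(** * Dimension of the faces *)

Section Dimension.
Variables (R : realType) (n : nat) (S : seq {set 'I_n}).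
Hypothesis ospS : ordered_set_partition S.

Local Notation point := (@perm_point R n).
Local Notation F := (partition_face S : set 'rV[R]_n).

(** As functionals, the columns are the block sums, which are constant on the
    face; they are the only obstruction to its being full-dimensional. *)
Definition block_mx : 'M[R]_(n, size S) := \matrix_(i, l) (block S i == l)%:R.

Lemma exists_block_rep : exists r : 'I_(size S) -> 'I_n, forall l, block S (r l) = l.
Proof.
have /choice[r rE] : forall l : 'I_(size S), exists i, block S i = l.
  by move=> l; exact: block_surj.
by exists r.
Qed.

Lemma rank_block_mx : \rank block_mx = size S.
Proof.
have [r rE] := exists_block_rep.
apply/eqP; rewrite eqn_leq rank_leq_col /=.
pose N : 'M[R]_(size S, n) := \matrix_(l, i) (i == r l)%:R.
have NM : \rank (N *m block_mx) = size S.
  rewrite (_ : N *m block_mx = 1%:M) ?mxrank1 //; apply/matrixP => l m.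
  rewrite !mxE (bigD1 (r l)) //= !mxE eqxx mul1r rE big1 ?addr0 // => i /negPf il.
  by rewrite mxE il mul0r.
by rewrite -[X in (X <= _)%N]NM mxrankM_maxr.
Qed.

Lemma size_osp_le : (size S <= n)%N.
Proof. by rewrite -rank_block_mx rank_leq_row. Qed.

Lemma dot_partition_face (y p q : 'rV[R]_n) :
  (forall i j, block S i = block S j -> y 0 i = y 0 j) ->
  F p -> F q -> dot y p = dot y q.
Proof.
move=> yS; have [s cs] := exists_compatible R ospS.
suff : F `<=` [set p | dot y p = dot y (point s)] by move=> H /H -> /H ->.
apply: conv_hull_sub => [x z t _ _ /= xE zE|_ [t ct <-] /=].
  by rewrite dot_comb xE zE; ring.
exact: (dot_compatible ospS).
Qed.

(** Differences of points of the face are killed by the [size S] independent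
    block sums. *)
Lemma affine_rank_le d : has_affine_rank F d -> (d <= n - size S)%N.
Proof.
case=> p [V [Fp FpV /eqP Vd]].
suff /mulmx0_rank_max : V *m block_mx = 0.
  by rewrite Vd rank_block_mx; have := size_osp_le; lia.
apply/matrixP => i l; rewrite !mxE.
pose y : 'rV[R]_n := \row_j block_mx j l.
have yS j k : block S j = block S k -> y 0 j = y 0 k by rewrite !mxE => ->.
have := dot_partition_face yS (FpV i) Fp.
rewrite -[X in dot y (X + _)]scale1r -[row i V]scale1r dot_comb !mul1r.
rewrite -[RHS]addr0 => /addrI/(etrans _); apply; rewrite /dot.
by apply: eq_bigr => j _; rewrite !mxE mulrC.
Qed.

(** Exchanging the value at each [i] with the value at a representative of its
    block gives the rows of [U], which are multiples of the vectors
    e_i - e_(rho i). A vector killed by [U] is constant on the blocks, so the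
    cokernel of [U] factors through [block_mx] and has rank at most [size S]. *)
Lemma has_affine_rank_partition_face : exists2 d,
  (n - size S <= d <= n)%N & has_affine_rank F d.
Proof.
have [r rE] := exists_block_rep; have [s cs] := exists_compatible R ospS.
pose rho i := r (Ordinal (block_lt ospS i)).
have rhoE i : block S (rho i) = block S i by rewrite rE.
pose U : 'M[R]_n := \matrix_i (point (tperm i (rho i) * s)%g - point s).
(* A maximal independent family of rows of U witnesses the affine rank. *)
exists (\rank U); last first.
  exists (point s), (rowsub (maxrankfun U) U); split.
  - by apply: sub_conv_hull; exists s.
  - move=> i; rewrite row_rowsub rowK addrC subrK; apply: sub_conv_hull.
    by exists (tperm (maxrankfun U i) (rho (maxrankfun U i)) * s)%g => //;
      apply: compatible_tperm.
  - exact: maxrowsub_free.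
rewrite rank_leq_row andbT leq_subCl -mxrank_coker.
pose C := cokermx U.
have CE i j : C i j = C (rho i) j.
  have [ri|nir] := eqVneq (rho i) i; first by rewrite ri.
  have : (row i U *m C) 0 j = 0 by rewrite -row_mul mulmx_coker row0 mxE.
  rewrite rowK perm_point_tperm addrAC subrr add0r -scalemxAl mulmxBl -!rowE !mxE.
  move/eqP; rewrite mulf_eq0 !subr_eq0 eqr_nat eqSS => /orP[|/eqP//].
  by move/eqP/val_inj/perm_inj/eqP; rewrite (negPf nir).
have -> : cokermx U = block_mx *m (\matrix_(l, j) C (r l) j).
  apply/matrixP => i j; rewrite -/C CE [RHS]mxE (bigD1 (Ordinal (block_lt ospS i))) //=.
  rewrite ![(\matrix_(_, _) _) _ _]mxE /= eqxx mul1r big1 ?addr0 // => l /negPf li.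
  by rewrite [block_mx i l]mxE eq_sym -[_ == _]/(l == Ordinal (block_lt ospS i)) li mul0r.
by rewrite (leq_trans (mxrankM_maxl _ _)) // rank_block_mx.
Qed.

Lemma poly_dim_partition_face : poly_dim F = (n - size S)%N.
Proof.
apply/eqP; rewrite eqn_leq; apply/andP; split.
  by apply/bigmax_leqP => d /asboolP; exact: affine_rank_le.
have [d /andP[ge_d le_d] rk_d] := has_affine_rank_partition_face.
have dn : (d < n.+1)%N by rewrite ltnS.
apply: leq_trans ge_d (@leq_bigmax_cond _ _ (fun e => nat_of_ord e) (Ordinal dn) _).
exact/asboolP.
Qed.

End Dimension.

(** The face of [S] contributes (-1)^(size S) times the product of the a_#|A| over
    the blocks, that is, the product of the weights - a_#|A|. *)
Lemma sum_faces (R : realType) (K : fieldType) (a : nat -> K) n :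
  \sum_(F \in faces (permutahedron R n)) (-1) ^+ (n - poly_dim F) * face_coef a F =
  osp_weight (fun k => - a k) n.
Proof.
rewrite facesE fsbig_image; last first.
  by move=> S S' /set_mem ospS /set_mem ospS'; exact: partition_face_inj.
have -> : @ordered_set_partition n = [set` osps n finset.setT].
  apply/seteqP; split=> S /=; rewrite mem_osps ?cardsT ?card_ord // is_ospE.
    by case=> S0 dS ->; rewrite S0 dS eqxx.
  by case/and3P => S0 dS /eqP.
rewrite -fsbig_seq ?osps_uniq // /osp_weight /osp_sum.
rewrite !big_seq; apply: eq_bigr => S; rewrite mem_osps ?cardsT ?card_ord //.
rewrite is_ospE => /and3P[S0 dS /eqP US].
have ospS : ordered_set_partition S by [].
rewrite poly_dim_partition_face // subKn ?(size_osp_le R) //.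
rewrite /face_coef face_partitionK //.
elim: {S0 dS US ospS} S => [|A S IH]; first by rewrite !big_nil mulr1.
by rewrite !big_cons -IH /= exprS; ring.
Qed.

Theorem theorem11p1 (R : realType) (K : fieldType)
    (charK0 : [pchar K] =i pred0) (a b : nat -> K)
    (bE : forall n : nat, (1 <= n)%N ->
       b n = \sum_(F \in faces (permutahedron R n))
               (-1) ^+ (n - poly_dim F) * face_coef a F) :
  fps_inverse (egf1 a) (egf1 b).
Proof. by apply: egf1_inverse => // n n0; rewrite bE // sum_faces. Qed.
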